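(* Let $f(z)=\sum_{\nu=0}^{m}a_\nu z^\nu\in\mathbb{C}[z]$ with $a_0\ne0$ and $a_m\neq0$. For every pair of coprime integers $q\ge2$, $1\le r<q$, the polynomial fibre determinant $D^f_{r,q}$ satisfies $$\deg D^f_{r,q}=qm+\frac{(q-1)(q-2)}2 .$$ Its leading coefficient has modulus $$\frac{|a_m|^q}{q}\prod_{\substack{\lambda^q=1\\ \lambda\ne1}}|1-m+m\lambda| ,$$ the product being over complex $q$-th roots of unity $\lambda\neq1$. For $m=0$ this equals $|a_0|^q/q$; for $m\ge1$ it equals $$\frac{|a_m|^q}{q}\bigl(m^q-(m-1)^q\bigr).$$
   Context: For $\alpha\in(0,1)$ the Bishop operator is $(T_\alpha f)(t)=t\,f(\{t+\alpha\})$, where $\{\cdot\}$ is the fractional part. For coprime $q\ge2$, $1\le r<q$, and $t$ in the fundamental interval $[0,1/q]$ (endpoint values understood as one-sided limits), the fibre matrix of $f$ is the $q\times q$ matrix $$M^f_{r,q}(t)_{\nu j}=\big(T_{r/q}^{j}f\big)(t+\nu/q),\qquad 0\le\nu,j\le q-1 .$$ Explicitly, with $c_{k}=(k \bmod q)/q$ and $k\bmod q\in\{0,\dots,q-1\}$, on the interior of the interval $$M^f_{r,q}(t)_{\nu j}=\left(\prod_{l=0}^{j-1}(t+c_{\nu+lr})\right) f(t+c_{\nu+jr}),$$ with empty products equal to $1$. The fibre determinant is $D^f_{r,q}(t)=\det M^f_{r,q}(t)$, a polynomial in $t$. *)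

(* Defs.v *)
From HB Require Import structures.
From mathcomp Require Import all_boot all_order all_algebra.
From mathcomp Require Import complex.
From mathcomp Require Import boolp classical_sets fsbigop reals topology normedtype.
Set Implicit Arguments.
Unset Strict Implicit.
Unset Printing Implicit Defensive.
Import Order.TTheory GRing.Theory Num.Theory.
Import numFieldNormedType.Exports.
Local Open Scope classical_set_scope.
Local Open Scope ring_scope.
Local Open Scope complex_scope.

Definition frac_part (R : realType) (x : R) : R := x - (Num.floor x)%:~R.

(* The operator acts on functions on [0, 1); such a function is represented by
   a total function on R.  Only its values on [0, 1) matter, since frac_part
   takes its values there. *)
Definition bishop (R : realType) (alpha : R) (f : R -> R[i]) : R -> R[i] :=
  fun t => t%:C * f (frac_part (t + alpha)).

Definition bishop_fibre_value (R : realType) (f : R -> R[i]) (q r nu j : nat)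
    (t : R) : R[i] :=
  iter j (bishop (r%:R / q%:R)) f (t + nu%:R / q%:R).

(* For t in [0, 1/q].  R[i]^o is R[i] with the topology given by its norm; at
   the two endpoints the entries are one-sided limits from inside [0, 1/q]. *)
Definition fibre_mx (R : realType) (f : R -> R[i]) (q r : nat) (t : R) :
    'M[R[i]]_q :=
  \matrix_(nu < q, j < q)
    (if t == 0 then
       lim ((bishop_fibre_value f q r nu j s : R[i]^o) @[s --> (0 : R)^'+])
     else if t == q%:R^-1 then
       lim ((bishop_fibre_value f q r nu j s : R[i]^o)
              @[s --> (q%:R^-1 : R)^'-])
     else bishop_fibre_value f q r nu j t).

Definition fibre_det (R : realType) (f : R -> R[i]) (q r : nat) (t : R) :
    R[i] :=
  \det (fibre_mx f q r t).

Definition nontrivial_unity_roots (R : realType) (q : nat) : set R[i] :=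
  [set l | l ^+ q = 1 /\ l <> 1].

(* Main.v *)
Require Import Defs.
From HB Require Import structures.
From mathcomp Require Import all_boot all_order all_algebra.
From mathcomp Require Import complex.
From mathcomp Require Import perm cyclic separable cyclotomic ring zify.
From mathcomp Require Import boolp classical_sets fsbigop reals topology normedtype.
Set Implicit Arguments.
Unset Strict Implicit.
Unset Printing Implicit Defensive.
Import Order.TTheory GRing.Theory Num.Theory.
Import numFieldNormedType.Exports.
Local Open Scope classical_set_scope.
Local Open Scope ring_scope.
Local Open Scope complex_scope.

(* Let z be a primitive q-th root of unity, and multiply the fibre matrix on the
   left by the Fourier matrix (z ^ (k * nu)).  The entry (k, j) of the product has
   degree at most m + j, and the term of degree m + j cancels for k != 0, so the
   degree drops by one in q - 1 rows.  The coefficients that are then on top only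
   involve the discrete Fourier transform 1 / (w - 1) of nu |-> nu / q; as a
   matrix they are a lower triangular matrix times the Fourier matrix of the
   primitive root y = z ^ (- r).  The two Fourier determinants have the same
   modulus, and the diagonal of the triangular factor gives the product. *)

(** * Top coefficients of products and determinants of polynomials *)

Lemma size_coef_mul_le (R : nzRingType) (p p' : {poly R}) (d d' : nat) :
  (size p <= d.+1)%N -> (size p' <= d'.+1)%N ->
  (size (p * p')%R <= (d + d').+1)%N /\ (p * p')`_(d + d') = p`_d * p'`_d'.
Proof.
move=> sp sp'; split; first by apply: leq_trans (size_polyMleq _ _) _; lia.
rewrite coefM (bigD1 (Ordinal (ltn_addr d' (ltnSn d)))) //= addKn big1 ?addr0 // => i.
rewrite -val_eqE /= neq_ltn => /orP[ltid|ltdi].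
  rewrite [p'`__]nth_default ?mulr0 //; apply: leq_trans sp' _.
  by move: ltid; move: (nat_of_ord i) => k; lia.
by rewrite nth_default ?mul0r //; apply: leq_trans sp _.
Qed.

Lemma size_coef_prod_le (R : comNzRingType) (I : Type) (s : seq I)
    (F : I -> {poly R}) (d : I -> nat) :
  (forall i, (size (F i) <= (d i).+1)%N) ->
  (size (\prod_(i <- s) F i)%R <= (\sum_(i <- s) d i).+1)%N /\
  (\prod_(i <- s) F i)`_(\sum_(i <- s) d i) = \prod_(i <- s) (F i)`_(d i).
Proof.
move=> sF; elim: s => [|i s [IHs IHc]]; first by rewrite !big_nil size_poly1 coef1.
by rewrite !big_cons; have [? ->] := size_coef_mul_le (sF i) IHs; rewrite IHc.
Qed.

(** In the Leibniz expansion the weights [r i + c (s i)] have the same sum for every permutation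
    [s], so all terms share one degree bound and their top coefficients reassemble into a
    determinant. *)
Lemma size_coef_det_le (R : comNzRingType) (n : nat) (A : 'M[{poly R}]_n)
    (r c : 'I_n -> nat) :
  (forall i j, (size (A i j) <= (r i + c j).+1)%N) ->
  (size (\det A) <= (\sum_i r i + \sum_j c j).+1)%N /\
  (\det A)`_(\sum_i r i + \sum_j c j) =
    \det (\matrix_(i, j) (A i j)`_(r i + c j)).
Proof.
move=> sA; set d := (\sum_i r i + _)%N.
have dE (s : {perm 'I_n}) : d = (\sum_i (r i + c (s i)))%N.
  by rewrite big_split /= [X in (_ + X)%N = _](reindex_inj (@perm_inj _ s)).
have main (s : {perm 'I_n}) := @size_coef_prod_le R _ (index_enum 'I_n)
  (fun i => A i (s i)) (fun i => (r i + c (s i))%N) (fun i => sA i (s i)).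
split.
  rewrite /determinant; apply: leq_trans (size_sum _ _ _) _; apply/bigmax_leqP => s _.
  rewrite -signr_odd; case: (odd _); rewrite ?expr1 ?mulN1r ?size_polyN ?expr0 ?mul1r.
    by case: (main s); rewrite -dE.
  by case: (main s); rewrite -dE.
rewrite /determinant coef_sum; apply: eq_bigr => s _.
have -> : (-1) ^+ s * \prod_i A i (s i) = ((-1) ^+ s : R)%:P * \prod_i A i (s i).
  by rewrite rmorphXn rmorphN1.
rewrite coefCM; congr (_ * _).
have [_ ] := main s; rewrite -dE => ->; apply: eq_bigr => i _; by rewrite mxE.
Qed.

(** * Roots of unity and the Fourier matrix *)

Lemma closed_prim_root_exists (C : numClosedFieldType) (n : nat) :
  (n > 0)%N -> exists z : C, n.-primitive_root z.
Proof.
pose p : {poly C} := 'X^n - 1; have [r Dp] := closed_field_poly_normal p.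
move=> n_gt0; rewrite (monicP _) ?monicXnsubC // scale1r in Dp.
have rn1: all n.-unity_root r by apply/allP=> z; rewrite -root_prod_XsubC -Dp.
have sz_r: (n < (size r).+1)%N.
  by rewrite -(size_prod_XsubC r id) -Dp size_XnsubC.
have [|z] := hasP (has_prim_root n_gt0 rn1 _ sz_r); last by exists z.
by rewrite -separable_prod_XsubC -Dp separable_Xn_sub_1 // pnatr_eq0 -lt0n.
Qed.

(** By induction on [s]: a cyclic shift by one only moves the first term to the end. *)
Lemma sum_shift_mod (V : nmodType) (q s : nat) (F : nat -> V) :
  (0 < q)%N ->
  \sum_(i < q) F ((i + s) %% q)%N = \sum_(i < q) F i.
Proof.
move=> q0; elim: s => [|s IH].
  by apply: eq_bigr => i _; rewrite addn0 modn_small.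
rewrite -IH; case: q q0 IH => // q _ _.
rewrite big_ord_recr big_ord_recl /= addrC; congr (_ + _).
  by rewrite add0n addnS -addSn modnDl.
by apply: eq_bigr => i _; rewrite /bump /= add1n addnS addSn.
Qed.

Lemma prim_root_neq1 (R : nzRingType) (q : nat) (z : R) (k : nat) :
  q.-primitive_root z -> (0 < k < q)%N -> z ^+ k != 1.
Proof.
move=> pz /andP[k0 kq]; rewrite -(prim_order_dvd pz).
by apply/negP => /(dvdn_leq k0); rewrite leqNgt kq.
Qed.

Lemma sum_unity_root (R : idomainType) (q : nat) (w : R) :
  w ^+ q = 1 -> w != 1 -> \sum_(i < q) w ^+ i = 0.
Proof.
move=> wq w1; have := subrX1 w q; rewrite wq subrr => /esym/eqP.
by rewrite mulf_eq0 subr_eq0 (negPf w1) => /eqP.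
Qed.

(** Multiplication by [w - 1] makes the sum telescope, up to a geometric sum that vanishes. *)
Lemma sum_natr_unity_root (F : fieldType) (q : nat) (w : F) :
  w ^+ q = 1 -> w != 1 -> \sum_(i < q) i%:R * w ^+ i = q%:R / (w - 1).
Proof.
move=> wq w1; have w10 : w - 1 != 0 by rewrite subr_eq0.
apply: (mulIf w10); rewrite divfK //.
have tele n : (\sum_(i < n) i%:R * w ^+ i) * (w - 1) =
    n%:R * w ^+ n - w * \sum_(i < n) w ^+ i.
  elim: n => [|n IH]; first by rewrite !big_ord0 !mul0r mulr0 subrr.
  rewrite !big_ord_recr /= mulrDl IH -natr1 exprS.
  by ring.
by rewrite tele wq mulr1 sum_unity_root // mulr0 subr0.
Qed.

Definition dft (R : pzRingType) (q : nat) (z : R) : 'M[R]_q :=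
  \matrix_(k < q, n < q) z ^+ (k * n).

(** The columns of the Fourier matrix are orthogonal with squared norm [q]. The value does not
    depend on [z], so two primitive roots give determinants of equal modulus. *)
Lemma norm_det_dft (C : numClosedFieldType) (q : nat) (z : C) :
  q.-primitive_root z -> `|\det (dft q z)| ^+ 2 = q%:R ^+ q.
Proof.
move=> pz; have q0 := prim_order_gt0 pz; have zq := prim_expr_order pz.
have zz : z * (z^*)%R = 1.
  by rewrite -normCK (_ : `|z| = 1) ?expr1n //; apply/eqP;
     rewrite -(pexpr_eq1 q0) // -normrX zq normr1.
have z0 : z != 0 by apply: contra_eq_neq zz => ->; rewrite mul0r eq_sym oner_eq0.
have zc : (z^*)%R = z^-1 by apply: (mulfI z0); rewrite zz mulfV.
rewrite normCK -det_map_mx -det_tr -det_mulmx -det_scalar.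
congr (\det _); apply/matrixP => n n'; rewrite !mxE.
transitivity (\sum_(k < q) (z ^+ n / z ^+ n') ^+ k).
  apply: eq_bigr => k _; rewrite !mxE rmorphXn /= zc exprVn.
  by rewrite [(k * n)%N]mulnC [(k * n')%N]mulnC !exprM -exprVn -exprMn.
have [<-|nn'] := eqVneq n n'.
  rewrite divff ?expf_neq0 // (eq_bigr (fun => 1)) => [|k _]; last by rewrite expr1n.
  by rewrite sumr_const card_ord.
have znq k : (z ^+ k) ^+ q = 1 by rewrite exprAC zq expr1n.
rewrite sum_unity_root //; first by rewrite exprMn exprVn !znq divr1.
rewrite -[1](@divff _ (z ^+ n')) ?expf_neq0 // (inj_eq (mulIf _)) ?invr_eq0 ?expf_neq0 //.
by rewrite (eq_prim_root_expr pz) !modn_small.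
Qed.

Lemma prod_prim_root_linear (F : fieldType) (q : nat) (z x y : F) :
  q.-primitive_root z -> \prod_(k < q) (x - y * z ^+ k) = x ^+ q - y ^+ q.
Proof.
move=> pz; have q0 := prim_order_gt0 pz.
have [->|y0] := eqVneq y 0.
  rewrite expr0n eqn0Ngt q0 subr0 (eq_bigr (fun => x)) => [|k _];
    last by rewrite mul0r subr0.
  by rewrite prodr_const card_ord.
have /(congr1 (horner^~ (x / y))) := factor_Xn_sub_1 pz.
rewrite big_mkord horner_prod !hornerE => H.
have -> : x ^+ q - y ^+ q = y ^+ q * ((x / y) ^+ q - 1).
  by rewrite mulrBr mulr1 -exprMn mulrCA divff ?mulr1.
rewrite -H -[q in y ^+ q]card_ord -prodr_const -big_split.
by apply: eq_bigr => k _; rewrite !hornerE /= mulrBr mulrCA divff ?mulr1.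
Qed.

(** Cancel ['X - 1] in the factorization of ['X^(p.+1) - 1] and evaluate at 1. *)
Lemma prod_sub1_prim_root (F : fieldType) (p : nat) (z : F) :
  p.+1.-primitive_root z -> \prod_(k < p) (1 - z ^+ k.+1) = p.+1%:R.
Proof.
move=> pz; have := factor_Xn_sub_1 pz.
rewrite big_mkord big_ord_recl /= expr0 subrX1 => /(mulfI _) H.
have : \prod_(k < p) ('X - (z ^+ k.+1)%:P) = \sum_(i < p.+1) 'X^i.
  by rewrite -H ?polyXsubC_eq0 //; apply: eq_bigr.
move=> /(congr1 (fun P => P.[1])); rewrite horner_prod horner_sum.
under eq_bigr do rewrite !hornerE.
move=> ->; rewrite (eq_bigr (fun => 1)) => [|i _]; last by rewrite hornerXn expr1n.
by rewrite sumr_const card_ord.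
Qed.

(** * Polynomial entries of the fibre matrix and their two top coefficients *)

(* [fibre_shift F q k] is c_k of the paper. *)
Definition fibre_shift (F : fieldType) (q k : nat) : F := (k %% q)%:R / q%:R.

Definition fibre_poly (F : fieldType) (f : {poly F}) (q r nu j : nat) : {poly F} :=
  (\prod_(l < j) ('X + (fibre_shift F q (nu + l * r))%:P)) *
  (f \Po ('X + (fibre_shift F q (nu + j * r))%:P)).

Definition fibre_poly_mx (F : fieldType) (f : {poly F}) (q r : nat) :
    'M[{poly F}]_q :=
  \matrix_(nu < q, j < q) fibre_poly f q r nu j.

(** Reindexing by the cyclic shift [s] pulls out the phase [w ^- s] and leaves the Fourier transform
    of [i / q]. *)
Lemma sum_shift_unity_root (F : fieldType) (q s : nat) (w : F) :
  q%:R != 0 :> F -> w ^+ q = 1 -> w != 1 ->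
  \sum_(i < q) w ^+ i * fibre_shift F q (i + s) = w ^- s / (w - 1).
Proof.
move=> qn0 wq w1; have q0 : (0 < q)%N by case: q qn0 {wq} => //; rewrite eqxx.
have wn0 : w != 0.
  by apply: contra_eq_neq wq => ->; rewrite expr0n eqn0Ngt q0 eq_sym oner_eq0.
transitivity (w ^- s / q%:R * \sum_(i < q) i%:R * w ^+ i).
  rewrite -(@sum_shift_mod _ q s (fun i => i%:R * w ^+ i)) // mulr_sumr.
  apply: eq_bigr => i _; rewrite expr_mod // exprD /fibre_shift.
  by field; rewrite qn0 expf_neq0.
rewrite sum_natr_unity_root //; field.
by rewrite subr_eq0 w1 qn0 expf_neq0.
Qed.

Lemma top_coefs_prod_XsubC (F : fieldType) (S : seq F) (a : F) (n : nat)
    (P := a *: \prod_(x <- S) ('X - x%:P)) :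
  size S = n ->
  [/\ (size P <= n.+1)%N, P`_n = a & ('X * P)`_n = - (a * \sum_(x <- S) x)].
Proof.
move=> Sn; have sP := size_prod_XsubC S id; rewrite Sn /= in sP.
split.
- by rewrite (leq_trans (size_scale_leq _ _)) ?sP.
- have /monicP := monic_prod_XsubC S xpredT id.
  by rewrite /lead_coef sP /= coefZ => ->; rewrite mulr1.
(* For [n = 0] both sides are 0; otherwise this is Viète's formula for the second coefficient. *)
- rewrite coefXM; case: n Sn {sP} => [/size0nil ->|n Sn] /=.
    by rewrite big_nil mulr0 oppr0.
  by have := @coefPn_prod_XsubC _ S; rewrite Sn /= coefZ => ->; rewrite ?mulrN.
Qed.

(* The second condition on the coefficients is phrased with ['X * P] so that it
   remains meaningful when [m + j = 0].  The constant [b] is the sum of the roots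
   of [f]: an entry of the matrix is [lead_coef f] times a product of monic linear
   factors. *)
Lemma top_coefs_fibre_poly (F : closedFieldType) (f : {poly F}) (m : nat) :
  size f = m.+1 ->
  exists b : F, forall q r nu j : nat,
  let P := fibre_poly f q r nu j in
  [/\ (size P <= (m + j).+1)%N, P`_(m + j) = lead_coef f &
    ('X * P)`_(m + j) = lead_coef f *
      (\sum_(l < j) fibre_shift F q (nu + l * r) +
       m%:R * fibre_shift F q (nu + j * r) - b)].
Proof.
move=> sf; have [s fE] := closed_field_poly_normal f.
have lf0 : lead_coef f != 0 by rewrite lead_coef_eq0 -size_poly_eq0 sf.
have ss : size s = m.
  by apply: succn_inj; rewrite -(size_prod_XsubC s id) -(size_scale _ lf0) -fE.
exists (\sum_(x <- s) x) => q r nu j /=.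
set c := fibre_shift F q.
(* The roots of the entry: those of the linear factors, then the translated roots of [f]. *)
set S := [seq - c (nu + l * r)%N | l : 'I_j <- enum 'I_j] ++
         [seq x - c (nu + j * r)%N | x <- s].
have PE : fibre_poly f q r nu j = lead_coef f *: \prod_(x <- S) ('X - x%:P).
  rewrite /fibre_poly [in LHS]fE comp_polyZ -scalerAr big_cat big_map big_enum big_map /=.
  congr (_ *: (_ * _)).
    by apply: eq_bigr => l _; rewrite polyCN opprK.
  rewrite (big_morph (fun P : {poly F} => P \Po _)
    (fun _ _ => comp_polyM _ _ _) (comp_polyC 1 _)).
  apply: eq_bigr => x _.
  by rewrite comp_polyB comp_polyX comp_polyC polyCB opprB addrA.
have Sn : size S = (m + j)%N.
  by rewrite size_cat (size_map _ s) (size_map _ (enum 'I_j)) size_enum_ord ss addnC.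
have [? ? top] := @top_coefs_prod_XsubC F S (lead_coef f) (m + j) Sn.
rewrite PE; split=> //; rewrite top -mulrN; congr (_ * _).
rewrite big_cat big_map big_enum big_map /= sumrN opprD opprK sumrB -addrA; congr (_ + _).
by rewrite big_const_seq count_predT ss iter_addr_0 mulr_natl opprB.
Qed.

(** * Degree bound and top coefficient of the polynomial determinant *)

(** Total of the row and column weights used for [B] below; the final [p.+1] is the degree of the
    factor ['X^q] of [\det B]. *)
Lemma sum_add_ord (m p : nat) :
  (\sum_(k < p.+1) (k == 0 :> nat) + \sum_(j < p.+1) (m + j) =
   p.+1 * m + ((p.+1 - 1) * (p.+1 - 2)) %/ 2 + p.+1)%N.
Proof.
rewrite big_split /= sum_nat_const card_ord big_ord_recl /= big1 // addn0.
have -> : (\sum_(j < p.+1) j = (p * (p - 1)) %/ 2 + p)%N.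
  elim: p => [|p IH]; first by rewrite big_ord_recr big_ord0.
  rewrite big_ord_recr /= IH; case: p {IH} => [|p] //.
  have -> : (p.+2 * (p.+2 - 1) = (p.+1 * (p.+1 - 1)) + p.+1 * 2)%N.
    by rewrite !subSS !subn0; nia.
  by rewrite [(_ + p.+1 * 2)%N]addnC divnMDl //; lia.
by rewrite subSS subn0 subSS; lia.
Qed.

(** The hypothesis [y * z ^+ r = 1] says that [y] is [z ^- r]. The degree is only bounded from above
    here; equality needs the product to be nonzero, which is shown in the theorem. *)
Lemma norm_coef_det_fibre_poly (C : numClosedFieldType) (p r m : nat)
    (f : {poly C}) (z y : C)
    (D := \det (fibre_poly_mx f p.+1 r))
    (d := (p.+1 * m + ((p.+1 - 1) * (p.+1 - 2)) %/ 2)%N) :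
  size f = m.+1 -> p.+1.-primitive_root z -> p.+1.-primitive_root y ->
  y * z ^+ r = 1 ->
  (size D <= d.+1)%N /\
  `|D`_d| = `|lead_coef f| ^+ p.+1 / p.+1%:R *
    \prod_(k < p) `|1 - m%:R + m%:R * y ^+ k.+1|.
Proof.
move=> sf pz py yz; have [b top] := top_coefs_fibre_poly sf.
set q := p.+1 in pz py d D *; set a := lead_coef f.
have qn0 : q%:R != 0 :> C by rewrite pnatr_eq0.
pose A := fibre_poly_mx f q r.
(* The factor 'X in each row avoids the degree bound [m + j - 1 = -1] in the rows
   [k != 0] when [m = j = 0]. *)
pose B : 'M[{poly C}]_q := 'X%:M *m (map_mx polyC (dft q z) *m A).
have BE k j : B k j = \sum_(nu < q) (z ^+ (k * nu))%:P * ('X * A nu j).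
  rewrite /B mul_scalar_mx !mxE mulr_sumr; apply: eq_bigr => nu _.
  by rewrite !mxE mulrCA.
have detB : \det B = 'X^q * ((\det (dft q z))%:P * D).
  by rewrite !det_mulmx det_scalar det_map_mx.
have zq := prim_expr_order pz.
have zr0 : z ^+ r != 0 by apply: contra_eq_neq yz => ->; rewrite mulr0 eq_sym oner_eq0.
have yE : y = z ^- r by apply: (mulIf zr0); rewrite yz mulVf.
have zkq k : (z ^+ k) ^+ q = 1 by rewrite exprAC zq expr1n.
have zk1 (k : 'I_q) : k != 0 :> nat -> z ^+ k != 1.
  by move=> k0; apply: (prim_root_neq1 pz); rewrite lt0n k0 ltn_ord.
have yk1 (k : 'I_q) : k != 0 :> nat -> y ^+ k != 1.
  by move=> k0; apply: (prim_root_neq1 py); rewrite lt0n k0 ltn_ord.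
(* For [k != 0] the coefficient of degree [m + j + 1] is [a] times the sum of the powers of
   [z ^+ k], hence 0. *)
have sB (k j : 'I_q) : (size (B k j) <= ((k == 0 :> nat) + (m + j)).+1)%N.
  apply/leq_sizeP => i; rewrite BE coef_sum.
  have [k0|kn0] /= := eqVneq (k : nat) 0%N => ij.
    apply: big1 => nu _; rewrite coefCM coefXM mxE.
    case: i ij => [|i] ij; first by rewrite mulr0.
    have [sP _ _] := top q r nu j.
    by rewrite nth_default ?mulr0 //; apply: leq_trans sP ij.
  case: i ij => // i; rewrite add0n ltnS leq_eqVlt => /orP[/eqP <-|ij].
    rewrite (eq_bigr (fun nu : 'I_q => (z ^+ k) ^+ nu * a)); last first.
      move=> nu _; rewrite coefCM coefXM mxE /= exprM.
      by have [_ -> _] := top q r nu j.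
    by rewrite -mulr_suml sum_unity_root ?mul0r ?zk1.
  apply: big1 => nu _; rewrite coefCM coefXM mxE /=.
  have [sP _ _] := top q r nu j.
  by rewrite nth_default ?mulr0 //; apply: leq_trans sP ij.
have [sdB cdB] := size_coef_det_le sB.
rewrite sum_add_ord -/q -/d in sdB cdB.
pose w (k : nat) := if k == 0%N then q%:R * a else
  a / ((z ^+ k - 1) * (y ^+ k - 1)) * (1 - m%:R + m%:R * y ^+ k).
(* The geometric sum of the powers of [y ^+ k] below [j] is [((y ^+ k) ^+ j - 1) / (y ^+ k - 1)].
   The part in [(y ^+ k) ^+ j] goes to the diagonal, the constant part to column 0. *)
pose U : 'M[C]_q := \matrix_(k, i) (if i == k then w k else
  if i == 0 :> nat then - (a / ((z ^+ k - 1) * (y ^+ k - 1))) else 0).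
have TE : (\matrix_(k, j) (B k j)`_((k == 0 :> nat) + (m + j))) = U *m dft q y.
  apply/matrixP => k j; rewrite [LHS]mxE [RHS]mxE BE coef_sum.
  have [k0|kn0] := eqVneq (k : nat) 0%N.
    rewrite [RHS](bigD1 k) //= [X in _ + X]big1 => [|i ik]; last first.
      have i0 : (i == 0 :> nat) = false.
        by rewrite -[X in _ == X]k0 (inj_eq val_inj) (negPf ik).
      by rewrite !mxE (negPf ik) i0 mul0r.
    rewrite !mxE eqxx /w k0 /= mul0n expr0 mulr1 addr0.
    rewrite (eq_bigr (fun => a)) ?sumr_const ?card_ord ?mulr_natl // => nu _.
    rewrite mul0n expr0 coefCM mul1r coefXM mxE /=.
    by have [_ -> _] := top q r nu j.
  have zw s : (z ^+ k) ^- (s * r) = (y ^+ k) ^+ s.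
    rewrite yE !exprVn -!exprM; congr (z ^+ _)^-1; lia.
  have z1 : z ^+ k - 1 != 0 by rewrite subr_eq0 zk1.
  have y1 : y ^+ k - 1 != 0 by rewrite subr_eq0 yk1.
  transitivity (a / (z ^+ k - 1) *
      (\sum_(l < j) (y ^+ k) ^+ l + m%:R * (y ^+ k) ^+ j)).
    (* Sum over [nu] first: the constant [b] then meets a vanishing sum of powers of [z ^+ k]. *)
    transitivity (a * (\sum_(l < j) \sum_(nu < q)
          (z ^+ k) ^+ nu * fibre_shift C q (nu + l * r)
        + m%:R * (\sum_(nu < q) (z ^+ k) ^+ nu * fibre_shift C q (nu + j * r))
        - b * (\sum_(nu < q) (z ^+ k) ^+ nu))).
      rewrite exchange_big /= !mulr_sumr -big_split -sumrB mulr_sumr /=.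
      apply: eq_bigr => nu _; rewrite coefCM mxE add0n exprM.
      by have [_ _ ->] := top q r nu j; rewrite -mulr_sumr -/a; ring.
    rewrite (sum_unity_root (zkq k) (zk1 _ kn0)) mulr0 subr0.
    rewrite (sum_shift_unity_root _ qn0 (zkq k) (zk1 _ kn0)) zw.
    under eq_bigr do rewrite (sum_shift_unity_root _ qn0 (zkq k) (zk1 _ kn0)) zw.
    by rewrite -mulr_suml; field.
  rewrite [RHS](bigD1 k) //= (bigD1 ord0) /=; last by rewrite -(inj_eq val_inj) eq_sym.
  rewrite [X in _ + (_ + X)]big1 => [|i /andP[ik i0]]; last first.
    by rewrite !mxE (negPf ik) (negPf (_ : i != 0 :> nat)) ?mul0r.
  rewrite !mxE eqxx /w (negPf kn0) -(inj_eq val_inj) /= eq_sym (negPf kn0) mul0n expr0.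
  rewrite addr0 mulr1 exprM.
  have := subrX1 (y ^+ k) j => /esym/(canRL (mulKf y1)) ->.
  by field; rewrite y1 z1.
have detU : \det U = \prod_(k < q) w k.
  rewrite det_trig; first by apply: eq_bigr => k _; rewrite mxE eqxx.
  apply/is_trig_mxP => k i ki; rewrite mxE.
  by rewrite -(inj_eq val_inj) /= !gtn_eqF // (leq_ltn_trans _ ki).
have prodw : `|\prod_(k < q) w k| = `|a| ^+ q / q%:R *
    \prod_(k < p) `|1 - m%:R + m%:R * y ^+ k.+1|.
  rewrite normr_prod big_ord_recl /= /w /=.
  (* The denominators of the [w k] contribute [q] for [z] and [q] for [y]; the factor [q] of [w 0]
     cancels one of them. *)
  have norm1 (x : C) : q.-primitive_root x ->
      \prod_(k < p) `|x ^+ k.+1 - 1| = q%:R.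
    move=> px; rewrite -normr_nat -(prod_sub1_prim_root px) normr_prod.
    by apply: eq_bigr => k _; rewrite distrC.
  under eq_bigr do rewrite /bump /= add1n normrM normf_div normrM.
  rewrite big_split /= prodf_div big_split /= !norm1 // prodr_const card_ord.
  by rewrite normrM normr_nat exprS; field.
have F0 : `|\det (dft q z)| != 0.
  by rewrite -sqrf_eq0 norm_det_dft // expf_neq0.
have FE : `|\det (dft q z)| = `|\det (dft q y)|.
  by apply/eqP; rewrite -(@eqrXn2 _ 2) // !norm_det_dft.
have coefD i : (\det B)`_(i + q) = \det (dft q z) * D`_i.
  by rewrite detB coefXnM coefCM addnK ltnNge leq_addl.
have detF0 : \det (dft q z) != 0 by rewrite -normr_eq0.
split.
  apply/leq_sizeP => i di; apply: (mulfI detF0); rewrite -coefD mulr0 nth_default //.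
  by apply: leq_trans sdB _; rewrite -addSn leq_add2r.
apply: (mulfI F0); rewrite -normrM -coefD cdB TE det_mulmx detU normrM prodw FE.
exact: mulrC.
Qed.

(** * From the Bishop operator to the polynomial entries on the fundamental interval *)

(** The integer part is [(k %% q + r) %/ q]: what remains is below 1 because a residue is at most
    [q - 1] and [t < 1 / q]. *)
Lemma frac_part_shift (R : realType) (q : nat) (t : R) (k r : nat) :
  (0 < q)%N -> 0 <= t < q%:R^-1 ->
  frac_part (t + (k %% q)%:R / q%:R + r%:R / q%:R) =
  t + ((k + r) %% q)%:R / q%:R.
Proof.
move=> q0 /andP[t0 tq]; have qR : 0 < q%:R :> R by rewrite ltr0n.
have qn0 : q%:R != 0 :> R by rewrite gt_eqF.
set n := (k %% q + r)%N.
have nE : n%:R = (n %/ q)%:R * q%:R + ((k + r) %% q)%:R :> R.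
  by rewrite -natrM -natrD -modnDml -divn_eq.
have -> : t + (k %% q)%:R / q%:R + r%:R / q%:R =
    t + ((k + r) %% q)%:R / q%:R + (n %/ q)%:R.
  by rewrite -addrA -mulrDl -natrD -/n nE mulrDl mulfK // [X in _ + X]addrC addrA.
rewrite /frac_part (@floor_def _ _ (n %/ q)%:Z) ?addrK //.
have m1 : ((k + r) %% q)%:R + 1 <= q%:R :> R by rewrite natr1 ler_nat ltn_pmod.
rewrite rmorphD /= lerDr [X in _ < X]addrC ltrD2r addr_ge0 ?divr_ge0 //=.
rewrite mulr1z -(ltr_pM2r qR) mulrDl divfK // mul1r (lt_le_trans _ m1) // addrC ltrD2l.
by rewrite -[X in _ < X](mulVf qn0) ltr_pM2r.
Qed.

Lemma fibre_polyS (F : fieldType) (f : {poly F}) (q r nu j : nat) :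
  fibre_poly f q r nu j.+1 =
  ('X + (fibre_shift F q nu)%:P) * fibre_poly f q r (nu + r) j.
Proof.
rewrite /fibre_poly big_ord_recl mul0n addn0 -mulrA; congr (_ * (_ * _)).
  by apply: eq_bigr => l _; rewrite /= /bump add1n mulSn addnA.
by rewrite mulSn addnA.
Qed.

(** The outermost operator gives the factor [l = 0] and replaces [nu] by [nu + r]. As this may
    exceed [q], the induction runs over all naturals [nu], taken modulo [q]. *)
Lemma bishop_iter_horner (R : realType) (f : {poly R[i]}) (q r : nat) (t : R)
    (nu j : nat) :
  (0 < q)%N -> 0 <= t < q%:R^-1 ->
  iter j (bishop (r%:R / q%:R)) (fun x : R => f.[x%:C]) (t + (nu %% q)%:R / q%:R) =
  (fibre_poly f q r nu j).[t%:C].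
Proof.
move=> q0 tq.
have castE k : (t + (k %% q)%:R / q%:R)%:C = t%:C + fibre_shift R[i] q k.
  by rewrite rmorphD fmorph_div !rmorph_nat.
elim: j nu => [|j IH] nu.
  rewrite /fibre_poly big_ord0 mul1r mul0n addn0 horner_comp !hornerE /=.
  by rewrite castE.
by rewrite iterS /bishop frac_part_shift // IH castE fibre_polyS !hornerE.
Qed.

Lemma cvg_horner_real_complex (R : realType) (p : {poly R[i]}) (x : R) :
  (p.[s%:C] : R[i]^o) @[s --> x] --> (p.[x%:C] : R[i]^o).
Proof.
have cvgC : (s%:C : R[i]^o) @[s --> x] --> (x%:C : R[i]^o).
  apply/cvgrPdist_lt => e e0; rewrite near_simpl.
  (* In the order of [R[i]] a positive element is real, so the estimate reduces to one in [R]. *)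
  have [e1 e2] : 0 < complex.Re e /\ e = (complex.Re e)%:C.
    by case: e e0 => a b; rewrite ltcE /= => /andP[/eqP -> ?]; split.
  near=> s; rewrite e2 -rmorphB normc_def /= expr0n /= addr0 sqrtr_sqr.
  rewrite ltcR; near: s.
  exact: (@cvgr_dist_lt _ _ _ (nbhs x) _ id x).
elim/poly_ind: p => [|p c IH].
  under eq_fun do rewrite horner0.
  by rewrite horner0; exact: cvg_cst.
under eq_fun do rewrite hornerMXaddC.
rewrite hornerMXaddC; apply: cvgD; last exact: cvg_cst.
exact: cvgM.
Unshelve. all: by end_near.
Qed.

(** At the endpoints the one-sided limits are values of the polynomials, by continuity. *)
Lemma fibre_mx_horner (R : realType) (f : {poly R[i]}) (q r : nat) (t : R) :
  (0 < q)%N -> 0 <= t <= q%:R^-1 ->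
  fibre_mx (fun x : R => f.[x%:C]) q r t =
  \matrix_(nu, j) (fibre_poly_mx f q r nu j).[t%:C].
Proof.
move=> q0 /andP[t0 tq]; have qR : 0 < q%:R :> R by rewrite ltr0n.
have qV : 0 < q%:R^-1 :> R by rewrite invr_gt0.
have val (nu j : 'I_q) (s : R) : 0 <= s < q%:R^-1 ->
    bishop_fibre_value (fun x : R => f.[x%:C]) q r nu j s =
    (fibre_poly f q r nu j).[s%:C].
  by move=> sq; rewrite /bishop_fibre_value -bishop_iter_horner // modn_small.
apply/matrixP => nu j; rewrite !mxE.
have [->|tn0] := eqVneq t 0.
  apply: (@cvg_lim R[i]^o); first exact: norm_hausdorff.
  have := cvg_at_right_filter (@cvg_horner_real_complex R (fibre_poly f q r nu j) 0).
  apply: cvg_trans; apply: near_eq_cvg; near=> s; rewrite val //.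
  by apply/andP; split; near: s; [exact: nbhs_right_ge|exact: nbhs_right_lt].
have [->|tnq] := eqVneq t q%:R^-1.
  apply: (@cvg_lim R[i]^o); first exact: norm_hausdorff.
  have := cvg_at_left_filter (@cvg_horner_real_complex R (fibre_poly f q r nu j) q%:R^-1).
  apply: cvg_trans; apply: near_eq_cvg; near=> s; rewrite val //.
  by apply/andP; split; near: s; [exact: nbhs_left_ge|exact: nbhs_left_lt].
by rewrite val // t0 lt_neqAle tnq.
Unshelve. all: by end_near.
Qed.

Lemma fibre_det_horner (R : realType) (f : {poly R[i]}) (q r : nat) (t : R) :
  (0 < q)%N -> 0 <= t <= q%:R^-1 ->
  (\det (fibre_poly_mx f q r)).[t%:C] = fibre_det (fun x : R => f.[x%:C]) q r t.
Proof.
move=> q0 tq; rewrite /fibre_det fibre_mx_horner // -/(horner_eval _ _) -det_map_mx.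
by congr (\det _); apply/matrixP => nu j; rewrite !mxE.
Qed.

(** * The product over nontrivial roots of unity and the exact degree *)

Lemma prod_nontrivial_unity_roots (R : realType) (p : nat) (y : R[i])
    (F : R[i] -> R[i]) :
  p.+1.-primitive_root y ->
  \big[*%R/1]_(l \in @nontrivial_unity_roots R p.+1) F l = \prod_(k < p) F (y ^+ k.+1).
Proof.
move=> py; pose s := [seq y ^+ k.+1 | k : 'I_p <- enum 'I_p].
have us : uniq s.
  rewrite map_inj_in_uniq ?enum_uniq // => k k' _ _ /eqP.
  by rewrite (eq_prim_root_expr py) !modn_small ?ltnS // eqSS => /eqP /val_inj.
have -> : @nontrivial_unity_roots R p.+1 = [set` s].
  apply/seteqP; split => l /=.
    move=> [lq l1]; have [[[|k] kp] /= lE] := prim_rootP py lq.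
      by case: l1; rewrite lE expr0.
    by rewrite lE; apply/mapP; exists (Ordinal (kp : (k < p)%N)); rewrite ?mem_enum.
  move=> /mapP[k _ ->]; split; first by rewrite exprAC (prim_expr_order py) expr1n.
  by apply/eqP; apply: (prim_root_neq1 py); rewrite /= ltnS.
by rewrite -fsbig_seq // big_map big_enum.
Qed.

Theorem lemma10 (R : realType) (m : nat) (a : nat -> R[i])
    (ha0 : a 0%N != 0) (ham : a m != 0)
    (q r : nat) (hq : (2 <= q)%N) (hr : (1 <= r < q)%N) (hqr : coprime q r) :
  let f : {poly R[i]} := \sum_(nu < m.+1) a nu *: 'X^nu in
  exists D : {poly R[i]},
    [/\ forall t : R, 0 <= t <= q%:R^-1 ->
          D.[t%:C] = fibre_det (fun x : R => f.[x%:C]) q r t,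
        size D = (q * m + ((q - 1) * (q - 2)) %/ 2).+1,
        `|lead_coef D| = `|a m| ^+ q / q%:R *
          \big[*%R/1]_(l \in @nontrivial_unity_roots R q)
             `|1 - m%:R + m%:R * l|,
        m = 0%N -> `|lead_coef D| = `|a 0%N| ^+ q / q%:R
      & (1 <= m)%N -> `|lead_coef D| =
          `|a m| ^+ q / q%:R * (m%:R ^+ q - (m%:R - 1) ^+ q)].
Proof.
move=> f; exists (\det (fibre_poly_mx f q r)).
have fE : f = \poly_(i < m.+1) a i by rewrite poly_def.
have sf : size f = m.+1 by rewrite fE size_poly_eq.
have lf : lead_coef f = a m by rewrite /lead_coef sf fE coef_poly ltnSn.
case: q hq hr hqr => // p hq hr hqr.
have [z pz] := @closed_prim_root_exists R[i] p.+1 isT.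
(* This is [z ^- r], since [z ^+ p] is the inverse of [z]; [p] and [r] are both coprime to
   [p.+1]. *)
pose y := z ^+ (p * r).
have py : p.+1.-primitive_root y.
  by rewrite prim_root_exp_coprime // coprimeMl coprimenS coprime_sym.
have yz : y * z ^+ r = 1.
  by rewrite -exprD addnC -mulSn exprM (prim_expr_order pz) expr1n.
have [sD cD] := norm_coef_det_fibre_poly sf pz py yz.
set D := \det _ in sD cD *; set d := (_ * m + _)%N in sD cD *.
set P := \prod_(k < p) _ in cD; rewrite lf in cD.
have P1 : (1 <= m)%N -> P = m%:R ^+ p.+1 - (m%:R - 1) ^+ p.+1.
  move=> m1; have m10 : 0 <= m%:R - 1 :> R[i] by rewrite subr_ge0 ler1n.
  (* With [x = m - 1] the factor [k = 0] is -1, and the other factors agree with those of [P] up to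
     sign. *)
  have := @prod_prim_root_linear _ _ y (m%:R - 1) m%:R py.
  rewrite big_ord_recl expr0 mulr1 addrAC subrr add0r => /(congr1 Num.norm).
  rewrite normrM normrN1 mul1r normr_prod [RHS]distrC.
  rewrite ger0_norm ?subr_ge0 ?lerXn2r ?nnegrE ?ler0n ?gerBl // => <-.
  by apply: eq_bigr => k _; rewrite /= /bump add1n -normrN; congr `|_|; ring.
have P0 : m = 0%N -> P = 1.
  by move=> m0; rewrite /P; apply: big1 => k _; rewrite m0 mul0r addr0 subr0 normr1.
have Pn0 : P != 0.
  case: (posnP m) => [/P0 ->|m1]; first exact: oner_neq0.
  rewrite (P1 m1) gt_eqF // subr_gt0 ltrXn2r ?nnegrE ?subr_ge0 ?ler1n ?ler0n //.
  by rewrite gtrBl ltr01.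
(* Nonvanishing at [d] turns the degree bound into an equality. *)
have Dd0 : D`_d != 0.
  by rewrite -normr_eq0 cD !mulf_neq0 ?invr_eq0 ?expf_neq0 ?normr_eq0 ?pnatr_eq0.
have sDd : size D = d.+1.
  by apply/eqP; rewrite eqn_leq sD ltnNge; apply: contra Dd0 => h; rewrite nth_default.
have lD : `|lead_coef D| = `|a m| ^+ p.+1 / p.+1%:R * P by rewrite /lead_coef sDd.
split=> // [t tq|||].
- exact: fibre_det_horner.
- by rewrite lD (prod_nontrivial_unity_roots _ py).
- by move=> m0; rewrite lD P0 // mulr1 m0.
- by move=> m1; rewrite lD P1.
Qed.
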